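(* Let $n\ge 4$ be an integer. Then for every $f:\mathbb{Z}_n\to[0,\infty)$, $$\int_{\mathbb{Z}_n} f^2\log f^2\,d\mu_n-\|f\|_2^2\log\|f\|_2^2\le 2\,\langle f,A_{\psi_n}f\rangle_{L_2(\mathbb{Z}_n,\mu_n)},$$ and the constant $2$ is optimal (the inequality for all such $f$ fails if $2$ is replaced by any smaller constant).
   Context: $\mathbb{Z}_n=\{0,1,\dots,n-1\}$ is the cyclic group with the normalized counting measure $\mu_n$ (each point has mass $1/n$); $\|f\|_2^2=\frac1n\sum_x|f(x)|^2$ and $\langle f,g\rangle_{L_2(\mathbb{Z}_n,\mu_n)}$ is the corresponding inner product. Convention: $0\log 0=0$. Let $\chi_k(x)=e^{2\pi i kx/n}$ for $0\le k\le n-1$ and $\psi_n(k)=\min(k,n-k)$. $A_{\psi_n}$ is the linear operator with $A_{\psi_n}\chi_k=\psi_n(k)\chi_k$, i.e. the generator of the semigroup $P_t=e^{-tA_{\psi_n}}$, $P_t\chi_k=e^{-t\psi_n(k)}\chi_k$. If $f=\sum_k a_k\chi_k$ then $\langle f,A_{\psi_n}f\rangle=\sum_k\psi_n(k)|a_k|^2$. *)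

(* Defs.v *)
From mathcomp Require Import all_boot all_order all_algebra.
From mathcomp Require Import complex reals exp trigo ring lra.

Set Implicit Arguments.
Unset Strict Implicit.
Unset Printing Implicit Defensive.

Import Order.TTheory GRing.Theory Num.Theory.

Local Open Scope ring_scope.
Local Open Scope complex_scope.

(* The underlying set {0, ..., n-1} of Z_n is 'I_n.  Its group law plays no
   role below: it only enters through the characters. *)

(* Integral against the normalized counting measure, for real-valued
   (F := R) and complex-valued (F := R[i]) functions alike. *)
Definition intZn (F : fieldType) (n : nat) (g : 'I_n -> F) : F :=
  n%:R^-1 * \sum_(x < n) g x.

Definition expi (R : realType) (t : R) : R[i] := cos t +i* sin t.

Definition chi (R : realType) (n : nat) (k x : 'I_n) : R[i] :=
  expi (2 * pi * k%:R * x%:R / n%:R).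

Definition psi (n k : nat) : nat := minn k (n - k).

Definition inner (R : realType) (n : nat) (f g : 'I_n -> R[i]) : R[i] :=
  intZn (fun x => f x * (g x)^*%C).

(* The Fourier multiplier with symbol psi n.  As the n characters are
   orthonormal (chi_orthonormal), hence a basis of the functions on Z_n, this
   is the unique linear operator (Apsi_linear) such that
   Apsi (chi k) = psi n k * chi k for all k (Apsi_chi). *)
Definition Apsi (R : realType) (n : nat) (f : 'I_n -> R[i]) : 'I_n -> R[i] :=
  fun x => \sum_(k < n) (psi n k)%:R * inner f (chi R k) * chi R k x.

(* <f, A f> for a real-valued f.  The inner product is already a real number
   (inner_Apsi), so nothing is lost by taking its real part. *)
Definition dirichlet (R : realType) (n : nat) (f : 'I_n -> R) : R :=
  let fC := fun x => (f x)%:C in complex.Re (inner fC (Apsi fC)).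

Definition normL2sq (R : realType) (n : nat) (f : 'I_n -> R) : R :=
  intZn (fun x => `|f x| ^+ 2).

(* The convention 0 log 0 = 0 holds automatically in both terms. *)
Definition entropy_sq (R : realType) (n : nat) (f : 'I_n -> R) : R :=
  intZn (fun x => f x ^+ 2 * ln (f x ^+ 2)) - normL2sq f * ln (normL2sq f).

Section Facts.
Variables (R : realType) (n : nat).
Implicit Types (f g : 'I_n -> R[i]) (k l x : 'I_n).

Lemma expiD (s t : R) : expi (s + t) = expi s * expi t.
Proof.
rewrite /expi cosD sinD; apply/eqP; rewrite eq_complex /= eqxx /=.
by apply/eqP; ring.
Qed.

Lemma expi_natM (t : R) (m : nat) : expi (t * m%:R) = expi t ^+ m.
Proof.
elim: m => [|m IH]; first by rewrite mulr0 expr0 /expi cos0 sin0.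
by rewrite -natr1 mulrDr mulr1 expiD IH exprSr.
Qed.

Lemma expiJ (t : R) : (expi t)^*%C = expi (- t).
Proof. by rewrite /expi cosN sinN. Qed.

Lemma expi_2pi (m : nat) : expi (2 * pi * m%:R) = 1 :> R[i].
Proof.
by rewrite expi_natM mulr_natl /expi cos2pi sin2pi expr1n.
Qed.

Lemma expi_eq1 (t : R) : expi (2 * t) = 1 -> sin t = 0.
Proof.
rewrite mulr_natl => -[c1 _]; move: c1; rewrite cos_mulr2n => c1.
have := cos2Dsin2 t => cs; apply/eqP; rewrite -sqrf_eq0; apply/eqP; lra.
Qed.

Lemma chi_orthonormal k l : inner (chi R k) (chi R l) = (k == l)%:R.
Proof.
have n0 : n%:R != 0 :> R[i].
  by rewrite pnatr_eq0 -lt0n; exact: leq_ltn_trans (ltn_ord k).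
have nR0 : n%:R != 0 :> R.
  by rewrite pnatr_eq0 -lt0n; exact: leq_ltn_trans (ltn_ord k).
pose t : R := pi * (k%:R - l%:R) / n%:R; pose z := expi (2 * t).
have chiE x : chi R k x * (chi R l x)^*%C = z ^+ x.
  by rewrite /chi expiJ -expiD -expi_natM; congr expi; rewrite /t; field.
rewrite /inner /intZn (eq_bigr _ (fun x _ => chiE x)).
have [kl|kl] := eqVneq k l.
  have -> : z = 1 by rewrite /z /t kl subrr mulr0 mul0r mulr0 /expi cos0 sin0.
  rewrite (eq_bigr (fun=> 1)) => [|x _]; last by rewrite expr1n.
  by rewrite sumr_const card_ord mulVf.
have zn : z ^+ n = 1.
  rewrite -expi_natM.
  have -> : 2 * t * n%:R = 2 * pi * k%:R + - (2 * pi * l%:R).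
    by rewrite /t; field.
  by rewrite expiD -expiJ !expi_2pi conjc1 mulr1.
have z1 : z != 1.
  apply/eqP => /expi_eq1 st0.
  have pos (a b : 'I_n) : (b < a)%N ->
      0 < sin (pi * (a%:R - b%:R) / n%:R : R).
    move=> ba; have npos : 0 < n%:R :> R by rewrite lt_def nR0 ler0n.
    apply: sin_gt0_pi; rewrite divr_gt0 ?mulr_gt0 ?pi_gt0 ?subr_gt0 ?ltr_nat//=.
    rewrite ltr_pdivrMr// ltr_pM2l ?pi_gt0// ltrBlDr -natrD ltr_nat.
    exact: ltn_addr.
  have := kl; rewrite neq_ltn => /orP[/pos|/pos].
    suff -> : sin (pi * (l%:R - k%:R) / n%:R : R) = 0 by rewrite ltxx.
    by rewrite -opprB mulrN mulNr sinN st0 oppr0.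
  by rewrite -/t st0 ltxx.
have := subrX1 z n; rewrite zn subrr => /esym/eqP.
by rewrite mulf_eq0 subr_eq0 (negbTE z1)/= => /eqP ->; rewrite mulr0.
Qed.

Lemma inner_linearl (a : R[i]) f g h :
  inner (fun x => a * f x + g x) h = a * inner f h + inner g h.
Proof.
rewrite /inner /intZn mulrCA -mulrDr; congr (_ * _).
by rewrite mulr_sumr -big_split/=; apply: eq_bigr => x _; ring.
Qed.

Lemma Apsi_linear (a : R[i]) f g x :
  Apsi (fun y => a * f y + g y) x = a * Apsi f x + Apsi g x.
Proof.
rewrite /Apsi mulr_sumr -big_split/=; apply: eq_bigr => k _.
by rewrite inner_linearl; ring.
Qed.

Lemma Apsi_chi k x : Apsi (chi R k) x = (psi n k)%:R * chi R k x.
Proof.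
rewrite /Apsi (bigD1 k)//= chi_orthonormal eqxx mulr1 big1 ?addr0// => l lk.
by rewrite chi_orthonormal eq_sym (negbTE lk) mulr0 mul0r.
Qed.

Lemma inner_Apsi f :
  inner f (Apsi f) = \sum_(k < n) (psi n k)%:R * `|inner f (chi R k)| ^+ 2.
Proof.
transitivity (\sum_(k < n)
    (psi n k)%:R * (inner f (chi R k))^*%C * inner f (chi R k)); last first.
  by apply: eq_bigr => k _; rewrite -mulrA (mulrC (_^*%C)) normCK.
rewrite {1}/inner /intZn.
under eq_bigr => x _ do rewrite /Apsi (raddf_sum conjc)/= mulr_sumr.
rewrite exchange_big/= mulr_sumr; apply: eq_bigr => k _.
rewrite [in RHS]mulrC {2}/inner /intZn -mulrA; congr (_ * _).
rewrite mulr_suml; apply: eq_bigr => x _.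
by rewrite !rmorphM/= conjc_nat; ring.
Qed.

End Facts.

(* Main.v *)
Require Import Defs.
From mathcomp Require Import all_boot all_order all_algebra.
From mathcomp Require Import complex reals exp trigo.
From mathcomp Require Import classical_sets functions topology normedtype.
From mathcomp Require Import sequences derive realfun zify ring lra.

(* Upper bound.  Normalize ||f||_2 = 1 and write f = a + s with a the mean and
   s = sum_(k != 0) a_k chi_k, so that m := ||s||_2^2 = 1 - a^2.  The third-order
   Taylor polynomial of t^2 ln t^2 at t = 1 dominates it on t >= 0, which bounds
   the entropy by 2/3 int f^3 + 4/3 - 2 a and reduces the claim to
     int s^3 <= (1 - a)^2 (1 + 2 a) + 3 sum_k (psi k - 1) |a_k|^2.
   Expand int s^3 as a sum of a_i a_j a_k over the triads i + j + k = 0, and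
   share each triad between its three indices, k receiving a portion w(i,j,k) of
   it, estimated by a_i a_j a_k <= (|a_i|^2 |a_j|^2 + |a_k|^2) / 2.  The portions
   are chosen so that every k <> 0 receives a total of at most 2 (psi k - 1),
   while w(i,j,-i-j) + w(-i,j,i-j) <= 1.  This gives
     int s^3 <= 3/4 m^2 + 3 sum_k (psi k - 1) |a_k|^2,
   and 3/4 m^2 <= (1 - a)^2 (1 + 2 a) amounts to (1 - a) (1 + 3 a) >= 0.

   Optimality.  For f = 1 + e cos (2 pi x / n), the Dirichlet form is
   M := e^2 int cos^2 and the entropy is at least (2 - 2 e) M. *)

Set Implicit Arguments.
Unset Strict Implicit.
Unset Printing Implicit Defensive.

Import Order.TTheory GRing.Theory Num.Theory numFieldNormedType.Exports.

Local Open Scope ring_scope.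

(** * Polynomial bounds for t^2 ln t^2 *)

(* The two sides agree to third order at u = 0; their difference has derivative
   2/3 expR (- u)^2 (expR u - 1)^3. *)
Lemma expR_taylor_ge (R : realType) (u : R) :
  2 * u <= 2 / 3 * expR u + 1 - 2 * expR (- u) + 3^-1 * expR (- u) ^+ 2.
Proof.
pose e : R -> R^o := expR \o -%R.
pose h : R -> R^o := (2 / 3) *: (expR : R -> R^o) + cst 1 - 2 *: e
                     + 3^-1 *: (e ^+ 2) - 2 *: (id : R -> R^o).
have hE v : h v = 2 / 3 * expR v + 1 - 2 * expR (- v)
                  + 3^-1 * expR (- v) ^+ 2 - 2 * v by [].
pose dh (v : R) := 2 / 3 * expR (- v) ^+ 2 * (expR v - 1) ^+ 3.
have dhE v : is_derive v (1 : R) h (dh v).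
  have de : is_derive v (1 : R) e (- expR (- v)).
    by apply: is_derive_eq; rewrite ?/GRing.scale /= mulrN1; exact: erefl.
  have dexp : is_derive v (1 : R) ((2 / 3) *: (expR : R -> R^o)) (2 / 3 * expR v).
    by apply: is_derive_eq.
  have dcst : is_derive v (1 : R) (cst 1 : R -> R^o) 0 by exact: is_derive_cst.
  have d2e : is_derive v (1 : R) (2 *: e) (- 2 * expR (- v)).
    by apply: is_derive_eq; rewrite /GRing.scale/= /e/=; ring.
  have de2 : is_derive v (1 : R) (3^-1 *: (e ^+ 2))
      (3^-1 * (2 * expR (- v) * - expR (- v))).
    by apply: is_derive_eq; rewrite /GRing.scale/= /e/=; ring.
  have did : is_derive v (1 : R) (2 *: (id : R -> R^o)) 2.
    by apply: is_derive_eq; rewrite /GRing.scale/= mulr1.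
  have dsum :=
    is_deriveB (is_deriveD (is_deriveB (is_deriveD dexp dcst) d2e) de2) did.
  suff -> : dh v = 2 / 3 * expR v + 0 - - 2 * expR (- v)
      + 3^-1 * (2 * expR (- v) * - expR (- v)) - 2 by exact: dsum.
  rewrite /dh expRN; have := expR_gt0 v.
  by move: (expR v) => y y0; field; exact: lt0r_neq0.
have dv v : derivable h v 1 by have [] := dhE v.
have h'E v : derive1 h v = dh v by rewrite derive1E; have [_ ->] := dhE v.
have hc A : {within A, continuous h}%classic.
  apply: continuous_subspaceT => v; apply: differentiable_continuous.
  exact/derivable1_diffP.
have h0 : h 0 = 0 by rewrite hE oppr0 expR0; field.
suff : 0 <= h u by rewrite hE subr_ge0.
(* The derivative has the sign of its argument, so [h] is minimal at 0, where it vanishes. *)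
rewrite -h0; have [u0|u0] := leP 0 u.
  apply: (@ger0_derive1_ndecry _ h 0) => // v; rewrite in_itv/= andbT => v0.
  rewrite h'E; apply: mulr_ge0; first by rewrite mulr_ge0 ?sqr_ge0 ?divr_ge0.
  by apply: exprn_ge0; rewrite subr_ge0 -[X in X <= _]expR0 ler_expR ltW.
apply: (@ler0_derive1_nincrNy _ h 0) => //; last exact: ltW.
move=> v; rewrite in_itv/= => v0; rewrite h'E; apply: mulr_ge0_le0.
  by rewrite mulr_ge0 ?sqr_ge0 ?divr_ge0.
by rewrite exprS mulr_le0_ge0 ?sqr_ge0// subr_le0 -[X in _ <= X]expR0 ler_expR ltW.
Qed.

(** Put u = ln t in [expR_taylor_ge] and multiply by t^2; at t = 0 the claim is 0 <= 1/3. *)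
Lemma sqr_ln_le (R : realType) (t : R) : 0 <= t ->
  t ^+ 2 * ln (t ^+ 2) <= 2 / 3 * t ^+ 3 + t ^+ 2 - 2 * t + 3^-1.
Proof.
rewrite le_eqVlt => /predU1P[<-|t0]; first by rewrite expr0n/= mul0r !mulr0; lra.
have := expR_taylor_ge (ln t); rewrite expRN lnK// => /(ler_wpM2l (sqr_ge0 t)) H.
rewrite lnXn// -[ln t *+ 2]mulr_natl; apply: (le_trans H).
rewrite le_eqVlt; apply/orP; left; apply/eqP; field; exact: lt0r_neq0.
Qed.

(** The same with u = - ln t; this direction serves the optimality. *)
Lemma sqr_ln_ge (R : realType) (t : R) : 0 < t ->
  2 * t ^+ 3 - t ^+ 2 - 2 / 3 * t - 3^-1 * t ^+ 4 <= t ^+ 2 * ln (t ^+ 2).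
Proof.
move=> t0; have := expR_taylor_ge (- ln t); rewrite expRN opprK lnK//.
move=> /(ler_wpM2l (sqr_ge0 t)); rewrite lnXn// -[ln t *+ 2]mulr_natl => H.
rewrite -lerN2 -!mulrN; apply: (le_trans H).
rewrite le_eqVlt; apply/orP; left; apply/eqP; field; exact: lt0r_neq0.
Qed.

(** * Portions of the triads i + j + k = 0 *)

(* n - 3 times the portion w(i,j,k) of the triad i + j + k = 0 received by k.  Up
   to sign a triad satisfies psi k = psi i + psi j for one of its indices, which
   then takes all of it, or else psi i + psi j + psi k = n, and it is shared
   proportionally to psi - 1. *)
Definition pivot_weight (n i j k : nat) : nat :=
  if ((0 < psi n i) && (0 < psi n j))%N then
    if (psi n k == psi n i + psi n j)%N then (n - 3)%N
    else if (psi n i + psi n j + psi n k == n)%N then (psi n k - 1)%N else 0%N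
  else 0%N.

Lemma val_oppZ n (i : 'I_n.+1) :
  nat_of_ord (- i) = if nat_of_ord i == 0%N then 0%N else (n.+1 - i)%N.
Proof.
rewrite /=; have := ltn_ord i; case: (nat_of_ord i) => [|m] mn.
  by rewrite subn0 modnn.
by rewrite modn_small//; lia.
Qed.

Lemma val_addZ n (i j : 'I_n.+1) :
  nat_of_ord (i + j) = if (i + j < n.+1)%N then (i + j)%N else (i + j - n.+1)%N.
Proof.
rewrite /=; have := ltn_ord i; have := ltn_ord j => jn in_.
case: ifP => ij; first by rewrite modn_small.
have {1}-> : (i + j = (i + j - n.+1) + n.+1)%N by lia.
by rewrite modnDr modn_small//; lia.
Qed.

Lemma neq0Z n (i : 'I_n.+1) : (i != 0) = (nat_of_ord i != 0%N).
Proof. by []. Qed.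

Lemma psi_oppZ n (i : 'I_n.+1) : psi n.+1 (- i)%R = psi n.+1 i.
Proof. by rewrite /psi val_oppZ; case: eqP => [->//|]; have := ltn_ord i; lia. Qed.

Lemma psi_gt0 n (i : 'I_n.+1) : i != 0 -> (0 < psi n.+1 i)%N.
Proof. by rewrite neq0Z /psi; have := ltn_ord i; lia. Qed.

Lemma double_psi n k : ((psi n k).*2 <= n)%N.
Proof. by rewrite /psi; lia. Qed.

(** [psi] is the distance to 0 on the cycle, so i and j are +-a and +-b. Their sum and difference
    are +-(a + b) and +-(a - b), in an order that depends on whether i and j lie in the same
    half. *)
Lemma psi_addZ n (i j : 'I_n.+1) (a := psi n.+1 i) (b := psi n.+1 j) :
  psi n.+1 (i + j)%R = (maxn a b - minn a b)%N /\
    psi n.+1 (- i + j)%R = minn (a + b) (n.+1 - (a + b)) \/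
  psi n.+1 (i + j)%R = minn (a + b) (n.+1 - (a + b)) /\
    psi n.+1 (- i + j)%R = (maxn a b - minn a b)%N.
Proof.
rewrite {}/a {}/b /psi !val_addZ !val_oppZ.
have := ltn_ord i; have := ltn_ord j.
move: (nat_of_ord i) (nat_of_ord j) => a b bn an.
have [->|a0] := eqVneq a 0%N.
  by rewrite !add0n bn; left; lia.
have [b2|b2] := leqP b (n.+1 - b); have [a2|a2] := leqP a (n.+1 - a).
- by right; split; do !case: ifP => ?; lia.
- by left; split; do !case: ifP => ?; lia.
- by left; split; do !case: ifP => ?; lia.
- by right; split; do !case: ifP => ?; lia.
Qed.

(** Write N for [n.+1]. By [psi_addZ], either one index has [psi] equal to the sum of the other two
    and gets N - 3, or the three values add up to N and the portions [psi] - 1 add up to N - 3. *)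
Lemma pivot_weight_cover n (i j : 'I_n.+1) (k := - (i + j)) : (4 <= n.+1)%N ->
  i != 0 -> j != 0 -> k != 0 ->
  (n.+1 - 3 <= pivot_weight n.+1 i j k + pivot_weight n.+1 j k i
               + pivot_weight n.+1 k i j)%N.
Proof.
move=> n4 /psi_gt0 i0 /psi_gt0 j0 /psi_gt0.
rewrite {}/k /pivot_weight !psi_oppZ i0 j0 => k0; rewrite !k0/=.
have := psi_addZ i j; have := double_psi n.+1 i; have := double_psi n.+1 j.
move: i0 j0 k0; move: (psi _ _) (psi _ j) (psi _ (i + j)%R) (psi _ _).
by move=> a b c d; do !case: ifP => ?; lia.
Qed.

(** With a = psi i and b = psi j, the triad whose third [psi] is |a - b| gives nothing unless max(a,
    b) = N / 2; in that case both portions are at most N / 2 - 2. *)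
Lemma pivot_weight_opp n (i j : 'I_n.+1) : (4 <= n.+1)%N -> i != 0 -> j != 0 ->
  (pivot_weight n.+1 i j (- (i + j))%R
   + pivot_weight n.+1 (- i)%R j (- (- i + j))%R <= n.+1 - 3)%N.
Proof.
move=> n4 /psi_gt0 i0 /psi_gt0 j0.
rewrite /pivot_weight !psi_oppZ i0 j0.
have := psi_addZ i j; have := double_psi n.+1 i; have := double_psi n.+1 j.
move: i0 j0; move: (psi _ _) (psi _ j) (psi _ (i + j)%R) (psi _ _).
by move=> a b c d; do !case: ifP => ?; lia.
Qed.

(** The values of - i (of i, if k is in the upper half) lie in 1, ..., psi k - 1. At 2 psi k = N
    both signs would occur and double the count. *)
Lemma card_sum_pivot n (k : 'I_n.+1) : (psi n.+1 k).*2 != n.+1 ->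
  (#|[pred i : 'I_n.+1 | [&& 0 < psi n.+1 i, 0 < psi n.+1 (- (i + k))%R &
     psi n.+1 k == psi n.+1 i + psi n.+1 (- (i + k))%R]%N]| <= psi n.+1 k - 1)%N.
Proof.
move=> kn; set A := [pred i : _ | _].
pose s := if (k < n.+1 - k)%N then iota (n.+1 - k).+1 (k - 1)
          else iota 1 (n.+1 - k - 1).
have -> : (psi n.+1 k - 1 = size s)%N.
  by rewrite /s /psi /minn; case: ifP => _; rewrite size_iota.
rewrite cardE -(size_map val); apply: uniq_leq_size.
  by rewrite (map_inj_uniq val_inj) enum_uniq.
apply/allP; rewrite all_map; apply/allP => i /=; rewrite mem_enum inE psi_oppZ.
move: kn; rewrite {}/s /psi val_addZ.
have := ltn_ord i; have := ltn_ord k.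
move: (nat_of_ord i) (nat_of_ord k) => a b bn an bb.
by case: (ltnP b _) => b2; rewrite mem_iota; case: ifP => ab; lia.
Qed.

Lemma sum_mem_card (T : finType) (A : {pred T}) : (\sum_x (x \in A))%N = #|A|.
Proof. by rewrite -sum1_card [RHS]big_mkcond; apply: eq_bigr => x _; case: ifP. Qed.

Lemma psi0 n : psi n 0 = 0%N.
Proof. by rewrite /psi min0n. Qed.

(** With p = psi k, at most N - 2 indices i have nonzero weight. If 2 p = N, bounding each weight by
    N - 3 suffices. Otherwise each is at most p - 1, except for at most p - 1 of them equal to N -
    3; the total (p - 1)(2 N - 4 - p) is small enough both for p = 1 and for p >= 2. *)
Lemma pivot_weight_sum n (k : 'I_n.+1) : (4 <= n.+1)%N -> k != 0 ->
  (\sum_(i < n.+1) pivot_weight n.+1 i (- (i + k))%R k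
    <= 2 * (psi n.+1 k - 1) * (n.+1 - 3))%N.
Proof.
move=> n4 k0; pose D : {pred 'I_n.+1} := [predC pred2 0 (- k)].
have cardD : (#|D| = n.+1 - 2)%N.
  have := cardC (pred2 0 (- k)).
  rewrite card_ord card2 eq_sym oppr_eq0 k0 => cD.
  apply/eqP; rewrite -(eqn_add2l 2) -/D.
  by rewrite [X in X == _]cD; apply/eqP; lia.
have WD (i : 'I_n.+1) : i \notin D -> pivot_weight n.+1 i (- (i + k))%R k = 0%N.
  rewrite !inE negbK /pivot_weight => /orP[]/eqP->; first by rewrite psi0.
  by rewrite addNr oppr0 psi0 andbF.
have := psi_gt0 k0; have := double_psi n.+1 k => psi2 psi_pos.
have [kn|kn] := eqVneq (psi n.+1 k).*2 n.+1.
  apply: (@leq_trans (\sum_(i < n.+1) (i \in D) * (n.+1 - 3))%N).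
    apply: leq_sum => i _; case: (boolP (i \in D)) => [_|/WD->//].
    by rewrite mul1n /pivot_weight; do !case: ifP => ?; lia.
  by rewrite -big_distrl/= sum_mem_card cardD leq_mul2r; apply/orP; right; lia.
have := card_sum_pivot kn; set A := [pred i : 'I_n.+1 | _] => cardA.
apply: (@leq_trans (\sum_(i < n.+1) ((i \in D) * (psi n.+1 k - 1)
    + (i \in A) * (n.+1 - 3 - (psi n.+1 k - 1))))%N).
  apply: leq_sum => i _; case: (boolP (i \in D)) => [_|/WD->//].
  rewrite mul1n /pivot_weight inE; case: (_ < _)%N => //=; case: (_ < _)%N => //=.
  by do !case: ifP => ?; rewrite ?mul1n; lia.
rewrite big_split/= -!big_distrl/= !sum_mem_card cardD.
move: (#|A|) cardA psi2 psi_pos kn => a; move: (psi _ _) => p; nia.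
Qed.

(** * The cubic estimate over triads *)

(** A triad is determined by any two of its indices, so the one receiving a portion can be moved to
    the outer sum. *)
Lemma sum_triad_rot (R : zmodType) n (F : 'I_n.+1 -> 'I_n.+1 -> 'I_n.+1 -> R) :
  \sum_i \sum_j F i j (- (i + j)) = \sum_i \sum_j F j (- (i + j)) i.
Proof.
rewrite [RHS]exchange_big/=; apply: eq_bigr => a _.
rewrite (reindex (fun i => - (i + a)))/=; last first.
  by exists (fun i => - (i + a)) => i _; rewrite [LHS]opprD opprK addrK.
by apply: eq_bigr => i _; rewrite [- (a - _)]opprD opprK [- a + _]addrC addrK.
Qed.

(** [c] stands for the moduli |a_k| of a real function of mean zero; c 0 = 0 also cancels the
    negative coefficient at index 0. *)
Lemma triad_sum_le (R : realFieldType) n (c : 'I_n.+1 -> R) :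
  (4 <= n.+1)%N -> (forall i, 0 <= c i) -> c 0 = 0 ->
  (forall i, c (- i) = c i) ->
  \sum_i \sum_j c i * c j * c (- (i + j))
    <= 3 / 4 * (\sum_i c i ^+ 2) ^+ 2
       + 3 * \sum_(i < n.+1) ((psi n.+1 i)%:R - 1) * c i ^+ 2.
Proof.
move=> n4 c0 c00 cN; pose W (i j k : 'I_n.+1) : R := (pivot_weight n.+1 i j k)%:R.
pose d i := c i ^+ 2; pose K : R := (n.+1 - 3)%:R.
have K0 : 0 < K by rewrite ltr0n; lia.
have d0 i : 0 <= d i by exact: sqr_ge0.
have dN i : d (- i) = d i by rewrite /d cN.
pose S := \sum_i \sum_j c i * c j * c (- (i + j)); rewrite -/S.
pose T := \sum_i \sum_j W i j (- (i + j)) * (c i * c j * c (- (i + j))).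
have ST : K * S <= 3 * T.
  have T1 : T = \sum_i \sum_j
      W j (- (i + j)) i * (c i * c j * c (- (i + j))).
    rewrite /T (sum_triad_rot (fun i j k => W i j k * (c i * c j * c k))).
    by apply: eq_bigr => i _; apply: eq_bigr => j _; ring.
  have T2 : T = \sum_i \sum_j
      W (- (i + j)) i j * (c i * c j * c (- (i + j))).
    rewrite T1 (sum_triad_rot (fun i j k => W j k i * (c i * c j * c k))).
    by apply: eq_bigr => i _; apply: eq_bigr => j _; ring.
  have -> : 3 * T = T + T + T by ring.
  rewrite {2}T1 {2}T2 /T -!big_split/= mulr_sumr; apply: ler_sum => i _.
  rewrite -!big_split/= mulr_sumr; apply: ler_sum => j _.
  rewrite -!mulrDl; have [->|i0] := eqVneq i 0; first by rewrite c00 !(mul0r, mulr0).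
  have [->|j0] := eqVneq j 0; first by rewrite c00 !(mul0r, mulr0).
  have [->|k0] := eqVneq (- (i + j)) 0; first by rewrite c00 !mulr0.
  rewrite ler_wpM2r ?mulr_ge0// /W -!natrD ler_nat.
  exact: pivot_weight_cover.
have TAB : 2 * T <= \sum_i \sum_j W i j (- (i + j)) * (d i * d j)
                  + \sum_i \sum_j W i j (- (i + j)) * d (- (i + j)).
  rewrite /T -big_split/= mulr_sumr; apply: ler_sum => i _.
  rewrite -big_split/= mulr_sumr; apply: ler_sum => j _.
  rewrite -mulrDr mulrCA ler_wpM2l ?ler0n// -subr_ge0.
  apply: le_trans (sqr_ge0 (c i * c j - c (- (i + j)))) _.
  by rewrite le_eqVlt; apply/orP; left; apply/eqP; rewrite /d; ring.
have A : 2 * (\sum_i \sum_j W i j (- (i + j)) * (d i * d j))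
         <= K * (\sum_i d i) ^+ 2.
  (* One of the two copies is reindexed by i -> - i, so that [pivot_weight_opp] bounds the paired
     weights by K. *)
  rewrite mulr_natl mulr2n {2}(reindex_inj oppr_inj)/= -big_split/=.
  rewrite expr2 mulr_suml mulr_sumr; apply: ler_sum => i _.
  rewrite -big_split/= !mulr_sumr; apply: ler_sum => j _.
  rewrite dN -mulrDl.
  have [->|i0] := eqVneq i 0; first by rewrite /d c00 expr0n/= !(mul0r, mulr0).
  have [->|j0] := eqVneq j 0; first by rewrite /d c00 expr0n/= !mulr0.
  by rewrite ler_wpM2r ?mulr_ge0// /W -natrD ler_nat pivot_weight_opp.
have B : \sum_i \sum_j W i j (- (i + j)) * d (- (i + j))
         <= 2 * K * \sum_(k < n.+1) ((psi n.+1 k)%:R - 1) * d k.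
  rewrite (sum_triad_rot (fun i j k => W i j k * d k)) mulr_sumr.
  apply: ler_sum => k _; rewrite -mulr_suml [X in _ <= X]mulrA.
  have [->|k0] := eqVneq k 0; first by rewrite /d c00 expr0n/= !mulr0.
  rewrite ler_wpM2r//; under eq_bigr => j _ do rewrite [k + j]addrC.
  rewrite -natr_sum -(natrB _ (psi_gt0 k0)) -!natrM ler_nat.
  by rewrite mulnAC; exact: pivot_weight_sum.
(* With [u] and [v] as below, 3 T <= 3/2 (K v^2 / 2 + 2 K u), hence the constants 3/4 and 3. *)
rewrite -(ler_pM2l K0).
move: (\sum_(i < n.+1) ((psi n.+1 i)%:R - 1) * d i) (\sum_i d i) A B TAB => u v.
lra.
Qed.

(** * Integration against the normalized counting measure *)

Section Integral.
Variables (F : fieldType) (n : nat).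
Implicit Types (f g : 'I_n -> F).

Lemma eq_intZn f g : f =1 g -> intZn f = intZn g.
Proof. by move=> fg; congr (_ * _); apply: eq_bigr => x _; rewrite fg. Qed.

Lemma intZnD f g : intZn (fun x => f x + g x) = intZn f + intZn g.
Proof. by rewrite /intZn big_split mulrDr. Qed.

Lemma intZnZ a f : intZn (fun x => a * f x) = a * intZn f.
Proof. by rewrite /intZn -mulr_sumr mulrCA. Qed.

Lemma intZn_sum (I : finType) (f : I -> 'I_n -> F) :
  intZn (fun x => \sum_i f i x) = \sum_i intZn (f i).
Proof. by rewrite /intZn exchange_big mulr_sumr. Qed.

End Integral.

Lemma intZn_cst (F : numFieldType) n (a : F) : intZn (fun _ : 'I_n.+1 => a) = a.
Proof.
by rewrite /intZn sumr_const card_ord -[a *+ _]mulr_natl mulKf// pnatr_eq0.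
Qed.

Lemma ler_intZn (F : numFieldType) n (f g : 'I_n -> F) :
  (forall x, f x <= g x) -> intZn f <= intZn g.
Proof. by move=> fg; rewrite ler_wpM2l ?invr_ge0 ?ler0n// ler_sum. Qed.

Lemma intZn_real (R : realType) n (f : 'I_n -> R) :
  (intZn f)%:C%C = intZn (fun x => (f x)%:C%C).
Proof.
rewrite /intZn rmorphM fmorphV rmorph_nat rmorph_sum/=.
by [].
Qed.

(** * Fourier analysis on the cyclic group *)

Section Fourier.
Variables (R : realType) (n : nat).
Local Notation N := n.+1.
Implicit Types (f g : 'I_N -> R[i]) (i j k x : 'I_N).

Lemma chi_sym k x : chi R k x = chi R x k.
Proof. by rewrite /chi [_ * k%:R * _]mulrAC. Qed.

Lemma expi0 : expi 0 = 1 :> R[i].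
Proof. by rewrite /expi cos0 sin0. Qed.

Lemma chiD i j x : chi R (i + j) x = chi R i x * chi R j x.
Proof.
have N0 : N%:R != 0 :> R by rewrite pnatr_eq0.
rewrite /chi -expiD val_addZ; case: ifP => ij.
  by congr expi; rewrite natrD; field; rewrite addrC natr1.
(* The index wraps around, which changes the phase by x full turns. *)
rewrite -[LHS]mulr1 -(expi_2pi R x) -expiD natrB; last by rewrite leqNgt ij.
by congr expi; rewrite natrD; field; rewrite addrC natr1.
Qed.

Lemma chi0 x : chi R (0 : 'I_N) x = 1.
Proof. by rewrite /chi mulr0 !mul0r expi0. Qed.

Lemma chiN i x : chi R (- i) x = (chi R i x)^*%C.
Proof.
have chiJ : chi R i x * (chi R i x)^*%C = 1 by rewrite /chi expiJ -expiD subrr expi0.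
by rewrite -[LHS]mulr1 -chiJ mulrA -chiD addNr chi0 mul1r.
Qed.

(** Characters are symmetric in index and point, so [chi_orthonormal] also gives the completeness
    relation that isolates y = x. *)
Lemma fourier_inversion f x : f x = \sum_k inner f (chi R k) * chi R k x.
Proof.
transitivity (\sum_y f y * inner (chi R x) (chi R y)).
  rewrite (bigD1 x)//= chi_orthonormal eqxx mulr1 big1 ?addr0// => y yx.
  by rewrite chi_orthonormal eq_sym (negbTE yx) mulr0.
rewrite /inner /intZn; under eq_bigr do rewrite mulrCA mulr_sumr.
rewrite -mulr_sumr exchange_big/= mulr_sumr; apply: eq_bigr => k _.
rewrite -[RHS]mulrA mulr_suml; congr (_ * _); apply: eq_bigr => y _.
by rewrite (chi_sym x) [_ * y%:R * _]mulrAC; ring.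
Qed.

Lemma parseval f : inner f f = \sum_k `|inner f (chi R k)| ^+ 2.
Proof.
rewrite {1}/inner.
under eq_intZn => x do rewrite {2}(fourier_inversion f x) (raddf_sum conjc)/= mulr_sumr.
rewrite intZn_sum; apply: eq_bigr => k _; rewrite normCK.
rewrite mulrC -[X in _ = _ * X]/(intZn _) -intZnZ; apply: eq_intZn => x.
by rewrite rmorphM/=; ring.
Qed.

(** Two factors are expanded; the third is integrated against chi_i chi_j, the conjugate of the
    character of index - (i + j). *)
Lemma int_cube f : intZn (fun x => f x ^+ 3) =
  \sum_i \sum_j inner f (chi R i) * inner f (chi R j) * inner f (chi R (- (i + j))).
Proof.
have fE x : f x ^+ 3 = \sum_i \sum_j inner f (chi R i) * inner f (chi R j)
    * (f x * (chi R (- (i + j)) x)^*%C).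
  rewrite !exprS expr0 mulr1 {1}(fourier_inversion f x) mulr_suml.
  apply: eq_bigr => i _; rewrite {1}(fourier_inversion f x) mulr_suml mulr_sumr.
  by apply: eq_bigr => j _; rewrite chiN conjcK chiD; ring.
rewrite (eq_intZn fE) intZn_sum; apply: eq_bigr => i _.
by rewrite intZn_sum; apply: eq_bigr => j _; rewrite intZnZ.
Qed.

(** The modulus is a real element of [R[i]]; [complex.Re] only brings it back to [R]. *)
Definition fourier_abs (s : 'I_N -> R) k : R :=
  complex.Re `|inner (fun x => (s x)%:C%C) (chi R k)|.

Lemma fourier_absE s k :
  (fourier_abs s k)%:C%C = `|inner (fun x => (s x)%:C%C) (chi R k)|.
Proof. by rewrite /fourier_abs RRe_real// normr_real. Qed.

Lemma fourier_abs_ge0 s k : 0 <= fourier_abs s k.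
Proof. by rewrite -lecR fourier_absE normr_ge0. Qed.

(** The coefficients of a real function at k and - k are conjugate. *)
Lemma fourier_absN s k : fourier_abs s (- k) = fourier_abs s k.
Proof.
rewrite /fourier_abs -[in RHS]norm_conjC; congr (complex.Re `|_|).
rewrite /inner /intZn rmorphM fmorphV rmorph_nat rmorph_sum; congr (_ * _).
apply: eq_bigr => x _; rewrite chiN [RHS]rmorphM.
by congr (_ * _); exact/esym/conjc_real.
Qed.

Lemma parseval_real (s : 'I_N -> R) :
  intZn (fun x => s x ^+ 2) = \sum_k fourier_abs s k ^+ 2.
Proof.
apply: (@complexI R); rewrite intZn_real rmorph_sum/=.
rewrite [LHS](_ : _ = inner (fun x => (s x)%:C%C) (fun x => (s x)%:C%C)).
  by rewrite parseval; apply: eq_bigr => k _; rewrite rmorphXn/= fourier_absE.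
by apply: eq_intZn => x; rewrite /= oppr0 -rmorphM -expr2.
Qed.

Lemma dirichletE (s : 'I_N -> R) :
  dirichlet s = \sum_(k < N) (psi N k)%:R * fourier_abs s k ^+ 2.
Proof.
rewrite /dirichlet inner_Apsi -[RHS]/(complex.Re (_%:C%C)) rmorph_sum.
congr complex.Re; apply: eq_bigr => k _.
by rewrite rmorphM rmorph_nat rmorphXn/= fourier_absE.
Qed.

Lemma int_cube_le (s : 'I_N -> R) : intZn (fun x => s x ^+ 3) <=
  \sum_i \sum_j fourier_abs s i * fourier_abs s j * fourier_abs s (- (i + j)).
Proof.
rewrite -lecR; apply: le_trans (real_ler_norm (_ : _%:C%C \is Num.real)) _.
  by rewrite complex_real.
rewrite intZn_real; under eq_intZn do rewrite rmorphXn/=.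
rewrite int_cube rmorph_sum (le_trans (ler_norm_sum _ _ _))// ler_sum// => i _.
rewrite rmorph_sum (le_trans (ler_norm_sum _ _ _))// ler_sum// => j _.
by rewrite 2!normrM -!fourier_absE -2!rmorphM.
Qed.

End Fourier.

(** * The inequality, first for unit norm and then in general *)

Lemma eq_inner (R : realType) n (f f' g g' : 'I_n -> R[i]) :
  f =1 f' -> g =1 g' -> inner f g = inner f' g'.
Proof. by move=> ff gg; apply: eq_intZn => x; rewrite ff gg. Qed.

(** A constant is a multiple of the character of index 0, orthogonal to the others. *)
Lemma fourier_absB_cst (R : realType) n (f : 'I_n.+1 -> R) (a : R) k : k != 0 ->
  fourier_abs (fun x => f x - a) k = fourier_abs f k.
Proof.
move=> k0; rewrite /fourier_abs; congr (complex.Re `|_|).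
have := inner_linearl (- a%:C)%C (@chi R n.+1 0) (fun x => (f x)%:C%C) (chi R k).
rewrite chi_orthonormal eq_sym (negbTE k0) mulr0 add0r => <-.
by apply: eq_inner => // x; rewrite chi0 mulr1 rmorphB/= addrC.
Qed.

Lemma fourier_abs0 (R : realType) n (f : 'I_n.+1 -> R) :
  fourier_abs f 0 = `|intZn f|.
Proof.
apply: (@complexI R); rewrite fourier_absE /inner.
under eq_intZn => x do rewrite chi0 conjc1 mulr1.
by rewrite -intZn_real normc_def/= expr0n addr0 sqrtr_sqr.
Qed.

Lemma dirichletB_cst (R : realType) n (f : 'I_n.+1 -> R) (a : R) :
  dirichlet (fun x => f x - a) = dirichlet f.
Proof.
rewrite !dirichletE; apply: eq_bigr => k _.
have [->|k0] := eqVneq k 0; first by rewrite psi0 !mul0r.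
by rewrite fourier_absB_cst.
Qed.

Lemma entropy_le_dirichlet_normalized (R : realType) n (f : 'I_n.+1 -> R) :
  (4 <= n.+1)%N -> (forall x, 0 <= f x) -> intZn (fun x => f x ^+ 2) = 1 ->
  intZn (fun x => f x ^+ 2 * ln (f x ^+ 2)) <= 2 * dirichlet f.
Proof.
move=> n4 f0 f1; pose a := intZn f; pose s x := f x - a; pose c := fourier_abs s.
have s0 : intZn s = 0.
  by rewrite intZnD intZn_cst subrr.
have a0 : 0 <= a by rewrite -(intZn_cst n 0) ler_intZn.
have c0 : c 0 = 0 by rewrite /c fourier_abs0 s0 normr0.
have s2 : intZn (fun x => s x ^+ 2) = 1 - a ^+ 2.
  rewrite (eq_intZn (g := fun x => f x ^+ 2 + ((- 2 * a) * f x + a ^+ 2))).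
    by rewrite !intZnD intZnZ intZn_cst f1 -/a; ring.
  by move=> x; rewrite /s; ring.
have f3 : intZn (fun x => f x ^+ 3)
    = a ^+ 3 + 3 * a * (1 - a ^+ 2) + intZn (fun x => s x ^+ 3).
  rewrite (eq_intZn (g := fun x => s x ^+ 3 +
     (3 * a * (s x ^+ 2) + (3 * a ^+ 2 * s x + a ^+ 3)))).
    by rewrite !intZnD !intZnZ intZn_cst s0 s2 mulr0 add0r addrC (addrC _ (a ^+ 3)).
  by move=> x; rewrite /s; ring.
have Df : dirichlet f = \sum_(k < n.+1) (psi n.+1 k)%:R * c k ^+ 2.
  by rewrite -dirichletE dirichletB_cst.
have a1 : a <= 1.
  have : 0 <= 1 - a ^+ 2.
    by rewrite -s2 -(intZn_cst n 0) ler_intZn// => x; exact: sqr_ge0.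
  by move=> ?; nra.
have := triad_sum_le n4 (fourier_abs_ge0 s) c0 (fourier_absN s).
move=> /(le_trans (int_cube_le s)).
under [X in _ <= _ + 3 * X]eq_bigr => k _ do rewrite mulrBl mul1r.
rewrite sumrB -parseval_real s2 -/c -Df => s3.
apply: (@le_trans _ _ (2 / 3 * intZn (fun x => f x ^+ 3) + 1 - 2 * a + 3^-1)).
  apply: le_trans (ler_intZn (fun x => sqr_ln_le (f0 x))) _.
  rewrite [X in X <= _](eq_intZn (g := fun x =>
    2 / 3 * f x ^+ 3 + (f x ^+ 2 + (- 2 * f x + 3^-1)))); last by move=> x; ring.
  by rewrite !intZnD !intZnZ intZn_cst f1 -/a mulNr !addrA lexx.
rewrite f3; move: (intZn _) (dirichlet f) s3 => S D s3.
(* Once [s3] bounds S, the slack left in the claim is one sixth of this product. *)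
have : 0 <= (1 - a) ^+ 2 * ((1 - a) * (1 + 3 * a)).
  by rewrite mulr_ge0 ?sqr_ge0// mulr_ge0; lra.
lra.
Qed.

Lemma intZn_gt0 (R : realType) n (f : 'I_n.+1 -> R) x :
  (forall y, 0 <= f y) -> 0 < f x -> 0 < intZn f.
Proof.
move=> f0 fx; rewrite mulr_gt0 ?invr_gt0 ?ltr0n//.
by rewrite (bigD1 x)//= ltr_wpDr// sumr_ge0.
Qed.

Lemma normL2sqE (R : realType) n (f : 'I_n -> R) :
  normL2sq f = intZn (fun x => f x ^+ 2).
Proof. by apply: eq_intZn => x; rewrite real_normK// num_real. Qed.

Lemma fourier_absZ (R : realType) n (a : R) (f : 'I_n.+1 -> R) k :
  fourier_abs (fun x => a * f x) k = `|a| * fourier_abs f k.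
Proof.
apply: (@complexI R); rewrite rmorphM/= !fourier_absE.
have -> : (`|a|)%:C%C = `|a%:C%C| by rewrite normc_def/= expr0n addr0 sqrtr_sqr.
rewrite -normrM -intZnZ; congr `|_|; apply: eq_intZn => x.
by rewrite rmorphM mulrA.
Qed.

Lemma dirichletZ (R : realType) n (a : R) (f : 'I_n.+1 -> R) :
  dirichlet (fun x => a * f x) = a ^+ 2 * dirichlet f.
Proof.
rewrite !dirichletE mulr_sumr; apply: eq_bigr => k _.
by rewrite fourier_absZ exprMn real_normK ?num_real// mulrCA.
Qed.

Lemma dirichlet_ge0 (R : realType) n (f : 'I_n.+1 -> R) : 0 <= dirichlet f.
Proof. by rewrite dirichletE sumr_ge0// => k _; rewrite mulr_ge0 ?sqr_ge0. Qed.

(** Both sides are homogeneous of degree 2, which reduces to unit norm; if the norm is 0, so is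
    f. *)
Lemma entropy_le_dirichlet (R : realType) n (f : 'I_n.+1 -> R) :
  (4 <= n.+1)%N -> (forall x, 0 <= f x) -> entropy_sq f <= 2 * dirichlet f.
Proof.
move=> n4 f0; rewrite /entropy_sq !normL2sqE; set m := intZn (fun x => f x ^+ 2).
have m_ge0 : 0 <= m by rewrite -(intZn_cst n 0) ler_intZn// => x; exact: sqr_ge0.
have [m0|m0] := eqVneq m 0.
  have fx0 x : f x = 0.
    apply/eqP/contraT => fx; suff : 0 < m by rewrite m0 ltxx.
    by apply: (@intZn_gt0 _ _ _ x) => [y|]; rewrite ?sqr_ge0// exprn_gt0// lt_def fx f0.
  rewrite (eq_intZn (g := fun=> 0)) ?intZn_cst; last first.
    by move=> x; rewrite fx0 expr0n/= mul0r.
  by rewrite m0 mul0r subr0 mulr_ge0// dirichlet_ge0.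
have m_gt0 : 0 < m by rewrite lt_def m0.
pose l := Num.sqrt m; pose g x := l^-1 * f x.
have l0 : 0 < l by rewrite sqrtr_gt0.
have l2 : l ^+ 2 = m by rewrite sqr_sqrtr.
have g0 x : 0 <= g x by rewrite mulr_ge0// invr_ge0 ltW.
have g2 : intZn (fun x => g x ^+ 2) = 1.
  rewrite (eq_intZn (g := fun x => m^-1 * f x ^+ 2)) ?intZnZ -/m ?mulVf//.
  by move=> x; rewrite exprMn exprVn l2.
have := entropy_le_dirichlet_normalized n4 g0 g2.
rewrite dirichletZ exprVn l2 => /(ler_wpM2l m_ge0).
rewrite [m * (2 * _)]mulrCA mulVKf// -intZnZ; apply: le_trans.
rewrite (eq_intZn (f := fun x => m * _)
  (g := fun x => f x ^+ 2 * ln (f x ^+ 2) + (- ln m) * f x ^+ 2)).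
  by rewrite intZnD intZnZ -/m mulNr mulrC.
move=> x; rewrite /g exprMn exprVn l2; have [->|fx] := eqVneq (f x) 0.
  by rewrite expr0n/= !(mul0r, mulr0) addr0.
rewrite lnM ?lnV ?posrE ?invr_gt0// ?exprn_even_gt0//.
by field.
Qed.

(** * Optimality: a constant perturbed by a cosine *)

Section Optimality.
Variables (R : realType) (n : nat).
Hypothesis n4 : (4 <= n.+1)%N.
Let i1 : 'I_n.+1 := inord 1.
Let u (x : 'I_n.+1) : R := cos (2 * pi * x%:R / n.+1%:R).

Let val_i1 : nat_of_ord i1 = 1%N.
Proof. by rewrite /i1 inordK//; lia. Qed.

Lemma cosine_fourier_abs k : k != i1 -> k != - i1 -> fourier_abs u k = 0.
Proof.
move=> k1 kN1; apply: (@complexI R); rewrite fourier_absE.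
(* The cosine is (chi_1 + chi_{-1}) / 2; the summand 0 lets [inner_linearl] apply twice. *)
pose h (x : 'I_n.+1) : R[i] := 2^-1 * chi R (- i1) x + 0.
rewrite (@eq_inner _ _ _ (fun x => 2^-1 * chi R i1 x + h x) _ (chi R k))//.
  rewrite !inner_linearl !chi_orthonormal ![_ == k]eq_sym (negbTE k1) (negbTE kN1).
  rewrite !mulr0 !add0r (_ : inner _ _ = 0) ?normr0// /inner.
  by under eq_intZn do rewrite mul0r; rewrite intZn_cst.
move=> x; rewrite /h addr0 chiN -mulrDr /chi val_i1 mulr1.
apply/eqP; rewrite eq_complex/=; apply/andP; split; apply/eqP.
  by rewrite /u; field.
by rewrite subrr; field.
Qed.

(** Only the frequencies +-1 are present, and there [psi] is 1. *)
Lemma dirichlet_cosine : dirichlet u = intZn (fun x => u x ^+ 2).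
Proof.
rewrite dirichletE parseval_real; apply: eq_bigr => k _.
have [->|k1] := eqVneq k i1; last have [->|kN1] := eqVneq k (- i1).
- by rewrite /psi val_i1; have -> : minn 1 (n.+1 - 1) = 1%N; [lia | rewrite mul1r].
- rewrite psi_oppZ /psi val_i1.
  by have -> : minn 1 (n.+1 - 1) = 1%N; [lia | rewrite mul1r].
- by rewrite cosine_fourier_abs// expr0n mulr0.
Qed.

Lemma int_cosine : intZn u = 0.
Proof.
apply/eqP; rewrite -normr_eq0 -fourier_abs0 cosine_fourier_abs//.
  by rewrite eq_sym neq0Z val_i1.
by rewrite eq_sym oppr_eq0 neq0Z val_i1.
Qed.

(* 1 + e u is written e u - (-1) to match dirichletB_cst. *)
Lemma cosine_perturbation_ge0 (e : R) : 0 < e -> e <= 2^-1 ->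
  forall x, 0 <= e * u x - (-1).
Proof.
move=> e0 e2 x; have u1 : 0 <= e * (u x + 1).
  by apply: mulr_ge0; [exact: ltW | rewrite -lerBlDr sub0r cos_geN1].
by rewrite mulrDr mulr1 in u1; lra.
Qed.

(** With M = dirichlet f <= e, [sqr_ln_ge] bounds the integral of f^2 ln f^2 below by (3 - e) M, and
    ln (1 + M) <= M bounds the subtracted term by (1 + e) M. *)
Lemma entropy_cosine_ge (e : R) (f := fun x => e * u x - (-1)) :
  0 < e -> e <= 2^-1 ->
  0 < dirichlet f /\ (2 - 2 * e) * dirichlet f <= entropy_sq f.
Proof.
move=> e0 e2; pose M := intZn (fun x => (e * u x) ^+ 2).
have su x : (e * u x) ^+ 2 <= e ^+ 2.
  rewrite exprMn ler_piMr ?sqr_ge0//.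
  by rewrite /u -[X in _ <= X](cos2Dsin2 (2 * pi * x%:R / n.+1%:R)) lerDl sqr_ge0.
have M0 : 0 < M.
  apply: (@intZn_gt0 _ _ _ 0) => [x|]; first exact: sqr_ge0.
  by rewrite /u mulr0 mul0r cos0 mulr1 exprn_gt0.
have Me : M <= e.
  apply: (@le_trans _ _ (e ^+ 2)); last by nra.
  by rewrite -(intZn_cst n (e ^+ 2)) ler_intZn.
have Df : dirichlet f = M.
  rewrite dirichletB_cst dirichletZ dirichlet_cosine -intZnZ.
  by apply: eq_intZn => x; rewrite exprMn.
have s0 : intZn (fun x => e * u x) = 0 by rewrite intZnZ int_cosine mulr0.
have f2 : normL2sq f = 1 + M.
  rewrite normL2sqE (eq_intZn (g := fun x => (e * u x) ^+ 2 + (2 * (e * u x) + 1))).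
    by rewrite !intZnD intZnZ s0 intZn_cst mulr0 add0r addrC.
  by move=> x; rewrite /f; ring.
split; first by rewrite Df.
rewrite Df /entropy_sq f2.
apply: (@le_trans _ _ ((3 - e) * M - (1 + M) * M)); first by nra.
apply: lerB; last first.
  by rewrite ler_wpM2l ?le_ln1Dx//; lra.
(* The added linear term has integral 0 and makes a pointwise comparison possible. *)
have -> : (3 - e) * M = intZn (fun x => 2 * (e * u x) + (3 - e) * (e * u x) ^+ 2).
  by rewrite intZnD !intZnZ int_cosine !mulr0 add0r.
apply: ler_intZn => x; rewrite /f; have := su x; move: (e * u x) => s se.
have s1 : - e <= s by rewrite lerNl; nra.
have t0 : 0 < s - -1 by lra.
apply: le_trans (sqr_ln_ge t0).
rewrite -subr_ge0.
(* The factored form is nonnegative since s >= - e and s^2 <= e^2 <= e. *)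
have -> : 2 * (s - -1) ^+ 3 - (s - -1) ^+ 2 - 2 / 3 * (s - -1) - 3^-1 * (s - -1) ^+ 4 -
     (2 * s + (3 - e) * s ^+ 2) = s ^+ 2 * (2 / 3 * (s + e) + 3^-1 * (e - s ^+ 2)).
  by field.
rewrite mulr_ge0 ?sqr_ge0//; nra.
Qed.

End Optimality.

Theorem theorem1p2 (R : realType) (n : nat) (hn : (4 <= n)%N) :
  (forall f : 'I_n -> R, (forall x, 0 <= f x) ->
     entropy_sq f <= 2 * dirichlet f) /\
  (forall c : R, c < 2 ->
     ~ (forall f : 'I_n -> R, (forall x, 0 <= f x) ->
          entropy_sq f <= c * dirichlet f)).
Proof.
case: n hn => [//|n] n4; split=> [f f0|c c2 H]; first exact: entropy_le_dirichlet.
(* For c > 0 the witness makes 2 - 2 e the midpoint of c and 2; for c <= 0, e = 1/2 gives 2 - 2 e =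
   1. *)
have [e [e0 e2 ec]] : exists e : R, [/\ 0 < e, e <= 2^-1 & c < 2 - 2 * e].
  have [c0|c0] := leP c 0; first by exists 2^-1; split; lra.
  by exists ((2 - c) / 4); split; lra.
have [D0 De] := entropy_cosine_ge n4 e0 e2.
have := le_trans De (H _ (cosine_perturbation_ge0 e0 e2)).
by rewrite (ler_pM2r D0) leNgt ec.
Qed.
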